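(* Let $H=\mathbb{C}[\mathcal{A}_4]$ with the differential calculus defined by the cyclic conjugacy class $\mathcal{C}=\{t,x,y,z\}$ of $\mathcal{A}_4$, where $t=(123)$, $x=(134)$, $y=(243)$, $z=(142)$. For the framing defined by the Maurer-Cartan form $\{e_a\}$ and the coframing $e^{*a}=\sum_{b\in\mathcal{C}}e_b\eta^{b,a}$ defined by a nondegenerate $\mathrm{Ad}$-invariant $\eta$, there exists a unique `Levi-Civita' connection (i.e. a unique regular, torsion free and cotorsion free connection), with component 1-forms $$A_a=e_a-\tfrac14\theta,\qquad\forall a\in\mathcal{C}.$$
   Context: $\mathcal{A}_4$ is the alternating group of order 12, with identity $e$; products of permutations are composed right to left. Differential calculus: $H=\mathbb{C}[\mathcal{A}_4]$ is the algebra of complex functions on $\mathcal{A}_4$, and $(R_af)(g)=f(ga)$. $\Omega^1(H)$ is the free left $H$-module with basis the Maurer-Cartan 1-forms $\{e_a\}_{a\in\mathcal{C}}$, with right module structure $e_af=R_a(f)e_a$, and $\mathrm{d}f=\sum_{a\in\mathcal{C}}(R_af-f)e_a$. Let $\Psi$ be the $H$-bimodule map on $\Omega^1(H)\otimes_H\Omega^1(H)$ with $\Psi(e_a\otimes_H e_b)=e_{aba^{-1}}\otimes_H e_a$. Then $\Omega^2(H)=(\Omega^1(H)\otimes_H\Omega^1(H))/\ker(\mathrm{id}-\Psi)$, with $\wedge$ the image in the quotient, and $\mathrm{d}e_a=\theta\wedge e_a+e_a\wedge\theta$, where $\theta=\sum_{a\in\mathcal{C}}e_a$; $\mathrm{d}$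 is $\mathbb{C}$-linear on 1-forms with $\mathrm{d}(fe_a)=\mathrm{d}f\wedge e_a+f\,\mathrm{d}e_a$. $\eta=(\eta^{a,b})_{a,b\in\mathcal{C}}$ is an invertible complex matrix which is $\mathrm{Ad}$-invariant: $\eta^{g^{-1}ag,b}=\eta^{a,gbg^{-1}}$ for all $a,b\in\mathcal{C}$, $g\in\mathcal{A}_4$. Connections: a (spin) connection is a collection $\{A_a\}_{a\in\mathcal{C}}$ of 1-forms $A_a\in\Omega^1(H)$. It is - torsion free if $\mathrm{d}e_a+\sum_{b\in\mathcal{C}}A_b\wedge(e_{b^{-1}ab}-e_a)=0$ for all $a\in\mathcal{C}$; - cotorsion free if $\mathrm{d}e^{*a}+\sum_{b\in\mathcal{C}}(e^{*bab^{-1}}-e^{*a})\wedge A_b=0$ for all $a\in\mathcal{C}$; - regular if $\sum_{a,b\in\mathcal{C};\,ab=g}A_a\wedge A_b=0$ for all $g\in\mathcal{A}_4$ with $g\neq e$, $g\notin\mathcal{C}$. *)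

(* Defs.v *)
From HB Require Import structures.
From mathcomp Require Import all_boot all_order all_algebra all_fingroup.
From mathcomp Require Import alt generic_quotient ring_quotient.
From mathcomp Require Import reals complex.

Set Implicit Arguments.
Unset Strict Implicit.
Unset Printing Implicit Defensive.

Import GRing.Theory.

Local Open Scope ring_scope.


(* MathComp composes permutations left to right: (s * t) i = t (s i).  The    *)
(* group law of A4 below is the opposite one, (g * h) i = g (h i).            *)
Record A4 : predArgType :=
  EvenPerm { perm_of :> {perm 'I_4}; perm_of_even : perm_of \in ('Alt_'I_4)%g }.

HB.instance Definition _ := [isSub for perm_of].
HB.instance Definition _ := [Finite of A4 by <:].

Definition A4_mul (g h : A4) : A4 :=
  EvenPerm (groupM (perm_of_even h) (perm_of_even g)).
Definition A4_one : A4 := EvenPerm (group1 ('Alt_'I_4)%g).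
Definition A4_inv (g : A4) : A4 := EvenPerm (groupVr (perm_of_even g)).

Fact A4_mulA : associative A4_mul.
Proof. by move=> f g h; apply: val_inj; rewrite /= mulgA. Qed.
Fact A4_mul1 : left_id A4_one A4_mul.
Proof. by move=> g; apply: val_inj; rewrite /= mulg1. Qed.
Fact A4_mulV : left_inverse A4_one A4_inv A4_mul.
Proof. by move=> g; apply: val_inj; rewrite /= mulgV. Qed.

HB.instance Definition _ := Finite_isGroup.Build A4 A4_mulA A4_mul1 A4_mulV.

Lemma A4_mulE (g h : A4) (i : 'I_4) : (g * h)%g i = g (h i).
Proof. by rewrite permM. Qed.

Lemma A4_invE (g : A4) (i j : 'I_4) : g i = j -> (g^-1)%g j = i.
Proof. by move=> <-; rewrite /= permK. Qed.

Lemma A4P (g h : A4) : (forall i, g i = h i) -> g = h.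
Proof. by move=> gh; apply: val_inj; apply/permP. Qed.

(* The permuted points 1, 2, 3, 4. *)
Definition p1 : 'I_4 := @Ordinal 4 0 isT.
Definition p2 : 'I_4 := @Ordinal 4 1 isT.
Definition p3 : 'I_4 := @Ordinal 4 2 isT.
Definition p4 : 'I_4 := @Ordinal 4 3 isT.

(* The cycle i -> j -> k -> i. *)
Definition cycle3 (i j k : 'I_4) : {perm 'I_4} := (tperm i j * tperm i k)%g.

Fact cycle3_even i j k :
  (i != j) && (i != k) -> cycle3 i j k \in ('Alt_'I_4)%g.
Proof. by case/andP=> ij ik; rewrite Alt_even odd_mul_tperm odd_tperm ij ik. Qed.

Definition t : A4 := EvenPerm (@cycle3_even p1 p2 p3 isT).
Definition x : A4 := EvenPerm (@cycle3_even p1 p3 p4 isT).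
Definition y : A4 := EvenPerm (@cycle3_even p2 p4 p3 isT).
Definition z : A4 := EvenPerm (@cycle3_even p1 p4 p2 isT).

Lemma forall_ord4 (P : 'I_4 -> Prop) :
  P p1 -> P p2 -> P p3 -> P p4 -> forall i, P i.
Proof.
move=> P1 P2 P3 P4 [[|[|[|[|m]]]] Hm] //.
- by rewrite (_ : Ordinal Hm = p1) //; apply: val_inj.
- by rewrite (_ : Ordinal Hm = p2) //; apply: val_inj.
- by rewrite (_ : Ordinal Hm = p3) //; apply: val_inj.
- by rewrite (_ : Ordinal Hm = p4) //; apply: val_inj.
Qed.

Lemma cycle3E i j k : uniq [:: i; j; k] ->
  [/\ cycle3 i j k i = j, cycle3 i j k j = k, cycle3 i j k k = i &
      forall l, l \notin [:: i; j; k] -> cycle3 i j k l = l].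
Proof.
rewrite /= !inE negb_or andbT => /andP[/andP[ij ik] jk].
rewrite /cycle3; split=> [||| l]; rewrite ?inE ?negb_or permM.
- by rewrite tpermL tpermD // eq_sym.
- by rewrite tpermR tpermL.
- by rewrite (tpermD ik jk) tpermR.
- by case/and3P=> li lj lk; rewrite !tpermD // eq_sym.
Qed.

Definition C : {set A4} := [set t; x; y; z].

Lemma conj_cycle3 (g : A4) i j k (H : cycle3 i j k \in ('Alt_'I_4)%g) :
  (g * EvenPerm H * g^-1)%g = cycle3 (g i) (g j) (g k) :> {perm 'I_4}.
Proof.
by rewrite /= /cycle3 -!tpermJ -conjMg.
Qed.

(* Parity of a permutation of four points from its values on three of them. *)
Lemma odd_perm4 (s : {perm 'I_4}) :
  let sw (u v w : 'I_4) := if w == u then v else if w == v then u else w in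
  odd_perm s = (p1 != s p1) (+) (p2 != sw p1 (s p1) (s p2))
    (+) (p3 != sw p2 (sw p1 (s p1) (s p2)) (sw p1 (s p1) (s p3))).
Proof.
set s1 := (s * tperm p1 (s p1))%g.
set s2 := (s1 * tperm p2 (s1 p2))%g.
set s3 := (s2 * tperm p3 (s2 p3))%g.
have swE (u v w : 'I_4) : tperm u v w =
    if w == u then v else if w == v then u else w by rewrite permE.
have s1p1 : s1 p1 = p1 by rewrite permM tpermR.
have fixD (r : {perm 'I_4}) u v : r u = u -> v != u -> tperm v (r v) u = u.
  move=> ru vu; rewrite tpermD // -[X in _ != X]ru.
  by rewrite (inj_eq perm_inj).
have s2p1 : s2 p1 = p1 by rewrite permM s1p1 fixD.
have s2p2 : s2 p2 = p2 by rewrite permM tpermR.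
have s3p1 : s3 p1 = p1 by rewrite permM s2p1 fixD.
have s3p2 : s3 p2 = p2 by rewrite permM s2p2 fixD.
have s3p3 : s3 p3 = p3 by rewrite permM tpermR.
have s3_1 : s3 = 1%g.
  apply/permP=> i; rewrite perm1; elim/forall_ord4: i => //.
  have := @perm_inj _ s3 p4; elim/forall_ord4: (s3 p4) => // H.
  - by have := H p1 (esym s3p1).
  - by have := H p2 (esym s3p2).
  - by have := H p3 (esym s3p3).
have := congr1 (@odd_perm _) s3_1.
rewrite odd_perm1 !odd_permM !odd_tperm /= -!swE -!permM mulgA -/s1 -/s2.
by case: (odd_perm s); case: (p1 != _); case: (p2 != _); case: (p3 != _).
Qed.

Lemma cycle3_rot i j k : uniq [:: i; j; k] -> cycle3 i j k = cycle3 j k i.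
Proof.
move=> u; have [ci cj ck cl] := cycle3E u.
have u' : uniq [:: j; k; i] by rewrite -[[:: j; k; i]]/(rot 1%N [:: i; j; k]) rot_uniq.
have [dj dk di dl] := cycle3E u'.
apply/permP=> l; have [|lN] := boolP (l \in [:: i; j; k]).
  by rewrite !inE => /or3P[] /eqP ->; rewrite ?ci ?cj ?ck.
by rewrite cl // dl // -[[:: j; k; i]]/(rot 1%N [:: i; j; k]) mem_rot.
Qed.

Definition C_perms : seq {perm 'I_4} :=
  [:: perm_of t; perm_of x; perm_of y; perm_of z].

Lemma mem_C (g : A4) : (g \in C) = (perm_of g \in C_perms).
Proof. by rewrite /C !inE orbA -!orbA -!val_eqE. Qed.

Lemma cycle3_even_image (s : {perm 'I_4}) : ~~ odd_perm s ->
  forall c, c \in C_perms -> 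
  (s^-1 * (c * s))%g \in C_perms.
Proof.
move=> s_even.
have rot i j k : (i, j, k) \in
    [:: (p1, p2, p3); (p2, p3, p1); (p3, p1, p2);
        (p1, p3, p4); (p3, p4, p1); (p4, p1, p3);
        (p2, p4, p3); (p4, p3, p2); (p3, p2, p4);
        (p1, p4, p2); (p4, p2, p1); (p2, p1, p4)] ->
    cycle3 i j k \in C_perms.
  rewrite !inE => H.
  do ?[case/orP: H => [/eqP[-> -> ->] | H]]; last case/eqP: H => -> -> ->;
    do ?[by rewrite /= eqxx ?orbT | rewrite cycle3_rot //].
have conjE i j k : (s^-1 * (cycle3 i j k * s))%g = cycle3 (s i) (s j) (s k).
  by rewrite /cycle3 -!tpermJ -conjMg.
have s_inj i j : i != j -> s i != s j by rewrite (inj_eq perm_inj).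
have u12 := @s_inj p1 p2 isT; have u13 := @s_inj p1 p3 isT.
have u14 := @s_inj p1 p4 isT; have u23 := @s_inj p2 p3 isT.
have u24 := @s_inj p2 p4 isT; have u34 := @s_inj p3 p4 isT.
move=> c cC; rewrite !inE in cC.
case/or4P: cC => /eqP -> /=; rewrite conjE; apply: rot;
  move: s_even u12 u13 u14 u23 u24 u34; rewrite odd_perm4;
  elim/forall_ord4: (s p1); elim/forall_ord4: (s p2); elim/forall_ord4: (s p3);
  elim/forall_ord4: (s p4); vm_compute; by [].
Qed.

Lemma C_conj (g a : A4) : a \in C -> (g * a * g^-1)%g \in C.
Proof.
rewrite !mem_C; apply: cycle3_even_image.
by have := perm_of_even g; rewrite Alt_even.
Qed.

Lemma C_class : C = (t ^: [set: A4])%g.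
Proof.
have conjC (g a b : A4) : perm_of (g * a * g^-1)%g = perm_of b -> b \in (a ^: [set: A4])%g.
  move/val_inj=> <-; apply/imsetP; exists (g^-1)%g; rewrite ?inE //.
  by rewrite /conjg invgK mulgA.
apply/setP/subset_eqP/andP; split; apply/subsetP=> a.
  rewrite !inE -!orbA => /or4P[] /eqP ->; first exact: class_refl.
  - apply: (conjC y^-1%g); apply: etrans (conj_cycle3 _ _) _.
    by rewrite (@A4_invE y p1 p1) ?(@A4_invE y p3 p2) ?(@A4_invE y p4 p3) //
      permM !permE.
  - apply: (conjC z^-1%g); apply: etrans (conj_cycle3 _ _) _.
    by rewrite (@A4_invE z p2 p1) ?(@A4_invE z p4 p2) ?(@A4_invE z p3 p3) //
      permM !permE.
  - apply: (conjC y); apply: etrans (conj_cycle3 _ _) _.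
    by rewrite !permM !permE /= cycle3_rot //.
case/imsetP=> g _ ->.
by rewrite /conjg mulgA -{2}[g]invgK C_conj // !inE eqxx.
Qed.

(* The elements of C, as index set of the Maurer-Cartan forms. *)
Record idx : predArgType := Idx { elt :> A4; elt_in_C : elt \in C }.

HB.instance Definition _ := [isSub for elt].
HB.instance Definition _ := [Finite of idx by <:].

(* Ad g a = g a g^-1 *)
Definition Ad (g : A4) (a : idx) : idx := Idx (C_conj g (elt_in_C a)).

Lemma Ad1 a : Ad 1%g a = a.
Proof. by apply: val_inj; rewrite /= mul1g invg1 mulg1. Qed.

Lemma AdM g h a : Ad (g * h)%g a = Ad g (Ad h a).
Proof. by apply: val_inj; rewrite /= invMg !mulgA. Qed.

(* H = C[A_4]; the complex numbers are R[i], for R a model of the reals. *)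
Notation FunA4 R := {ffun A4 -> R[i]}.
Notation Omega1 R := {ffun idx -> (FunA4 R)^o}.
(* Omega1 (x)_H Omega1 is free as a left H-module, with basis the             *)
(* e_a (x)_H e_b; see tens_balanced and tens_universal below.                 *)
Notation Omega1x1 R := {ffun idx * idx -> (FunA4 R)^o}.

(* Locked: unification is slow at comparing the boolean equalities in its body. *)
HB.lock Definition e (R : realType) (a : idx) : Omega1 R :=
  [ffun b => (b == a)%:R].

Lemma eE (R : realType) (a b : idx) : e R a b = (b == a)%:R :> FunA4 R.
Proof. by rewrite e.unlock ffunE. Qed.

Section Calculus.

Variable R : realType.
Implicit Types (f g : FunA4 R) (u v : Omega1 R) (w : Omega1x1 R) (a b : idx).

Local Notation e := (e R).

Definition cst (c : R[i]) : FunA4 R := [ffun=> c].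

Definition Rtrans (s : A4) f : FunA4 R := [ffun g => f (g * s)%g].

Fact Rtrans_is_zmod_morphism s : zmod_morphism (Rtrans s).
Proof. by move=> f g; apply/ffunP=> i; rewrite !ffunE. Qed.
HB.instance Definition _ s :=
  GRing.isZmodMorphism.Build (FunA4 R) (FunA4 R) (Rtrans s) (Rtrans_is_zmod_morphism s).
Fact Rtrans_is_monoid_morphism s : monoid_morphism (Rtrans s).
Proof. by split=> [|f g]; apply/ffunP=> i; rewrite !ffunE. Qed.
HB.instance Definition _ s :=
  GRing.isMonoidMorphism.Build (FunA4 R) (FunA4 R) (Rtrans s)
    (Rtrans_is_monoid_morphism s).

Lemma RtransM (s r : A4) f : Rtrans (s * r)%g f = Rtrans s (Rtrans r f).
Proof. by apply/ffunP=> i; rewrite !ffunE mulgA. Qed.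

Lemma FunA4_mulC f g : f * g = g * f.
Proof. by apply/ffunP=> i; rewrite !ffunE mulrC. Qed.

(* Right module structures: e_a f = R_a(f) e_a. *)
Definition rmul1 u f : Omega1 R := [ffun a => u a * Rtrans a f].
Definition rmul1x1 w f : Omega1x1 R :=
  [ffun ab => w ab * Rtrans (ab.1) (Rtrans (ab.2) f)].

(* (f e_a) (x)_H (g e_b) = f R_a(g) e_a (x)_H e_b *)
Definition tens u v : Omega1x1 R :=
  [ffun ab => u ab.1 * Rtrans (ab.1) (v ab.2)].

Lemma Omega1_basis u : u = \sum_a (u a : FunA4 R) *: e a.
Proof.
apply/ffunP=> b; rewrite sum_ffunE (bigD1 b) //= big1 ?addr0.
  by rewrite ffunE eE eqxx [RHS]mulr1.
by move=> a /negPf ab; rewrite ffunE eE eq_sym ab [LHS]mulr0.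
Qed.

Lemma tensDl u1 u2 v : tens (u1 + u2) v = tens u1 v + tens u2 v.
Proof. by apply/ffunP=> ab; rewrite !ffunE mulrDl. Qed.

Lemma tensDr u v1 v2 : tens u (v1 + v2) = tens u v1 + tens u v2.
Proof. by apply/ffunP=> ab; rewrite !ffunE rmorphD mulrDr. Qed.

Lemma tensZl f u v : tens (f *: u) v = f *: tens u v.
Proof. by apply/ffunP=> ab; rewrite !ffunE [LHS]/= -mulrA. Qed.

Lemma tens_rmul u v f : tens u (rmul1 v f) = rmul1x1 (tens u v) f.
Proof. by apply/ffunP=> ab; rewrite !ffunE rmorphM mulrA. Qed.

Lemma tens_balanced u f v : tens (rmul1 u f) v = tens u (f *: v).
Proof. by apply/ffunP=> ab; rewrite !ffunE rmorphM mulrA. Qed.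

Lemma tensE u v a b :
  tens u v (a, b) = u a * Rtrans a (v b) :> FunA4 R.
Proof. by rewrite ffunE. Qed.

Lemma tensZ_e f a b c d :
  tens (f *: e a) (e b) (c, d) = (if (c, d) == (a, b) then f else 0) :> FunA4 R.
Proof.
rewrite tensZl ffunE tensE !eE xpair_eqE.
have -> : Rtrans c (d == b)%:R = (d == b)%:R by rewrite rmorph_nat.
by rewrite -natrM mulnb; case: (_ && _); [exact: mulr1 | exact: mulr0].
Qed.

Lemma Omega1x1_basis w :
  w = \sum_a \sum_b tens ((w (a, b) : FunA4 R) *: e a) (e b).
Proof.
rewrite pair_big /=; apply/ffunP=> -[c d]; rewrite sum_ffunE.
rewrite (bigD1 (c, d)) //= big1 ?addr0.
  by rewrite tensZ_e eqxx.
by case=> a b ab; rewrite tensZ_e eq_sym (negPf ab).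
Qed.

Lemma tens_universal (M : zmodType) (phi : Omega1 R -> Omega1 R -> M) :
    (forall u1 u2 v, phi (u1 + u2) v = phi u1 v + phi u2 v) ->
    (forall u v1 v2, phi u (v1 + v2) = phi u v1 + phi u v2) ->
    (forall u f v, phi (rmul1 u f) v = phi u (f *: v)) ->
  exists2 h : Omega1x1 R -> M,
    zmod_morphism h /\ (forall u v, h (tens u v) = phi u v) &
    forall h' : Omega1x1 R -> M,
      zmod_morphism h' -> (forall u v, h' (tens u v) = phi u v) -> h' =1 h.
Proof.
move=> phiDl phiDr phi_bal.
have phi0l v : phi 0 v = 0 by apply: (addrI (phi 0 v)); rewrite -phiDl !addr0.
have phi0r u : phi u 0 = 0 by apply: (addrI (phi u 0)); rewrite -phiDr !addr0.
have phi_suml F v : phi (\sum_(a : idx) F a) v = \sum_a phi (F a) v.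
  by apply: (big_morph (fun u => phi u v)).
have phi_sumr F u : phi u (\sum_(a : idx) F a) = \sum_a phi u (F a).
  by apply: (big_morph (phi u)).
pose h w := \sum_a \sum_b phi ((w (a, b) : FunA4 R) *: e a) (e b).
have hD w1 w2 : h (w1 + w2) = h w1 + h w2.
  rewrite /h -big_split; apply: eq_bigr => a _.
  rewrite -big_split; apply: eq_bigr => b _.
  by rewrite ffunE scalerDl phiDl.
have h_tens u v : h (tens u v) = phi u v.
  rewrite [in RHS](Omega1_basis u) phi_suml; apply: eq_bigr => a _.
  rewrite [in RHS](Omega1_basis v) phi_sumr; apply: eq_bigr => b _.
  rewrite -phi_bal; congr phi; apply/ffunP=> c; rewrite ffunE tensE [RHS]ffunE ffunE !eE.
  case: eqP => [->|_]; first by rewrite /GRing.scale /= !mulr1.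
  by rewrite /GRing.scale /= !mulr0 mul0r.
have h0 : h 0 = 0 by apply: (addrI (h 0)); rewrite -hD !addr0.
exists h.
  split=> // w1 w2; apply: (addIr (h w2)).
  by rewrite -hD !subrK.
move=> h' h'B h'E w.
have h'0 : h' 0 = 0 by have := h'B 0 0; rewrite !subrr.
have h'D : {morph h' : w1 w2 / w1 + w2}.
  by move=> w1 w2; apply: (addIr (- h' w2)); rewrite -h'B !addrK.
rewrite [in LHS](Omega1x1_basis w) (big_morph h' h'D h'0); apply: eq_bigr => a _.
rewrite (big_morph h' h'D h'0); apply: eq_bigr => b _; exact: h'E.
Qed.

(* The left H-linear extension of e_a (x) e_b |-> e_(a b a^-1) (x) e_a. *)
Definition Psi w : Omega1x1 R :=
  \sum_a \sum_b (w (a, b) : FunA4 R) *: tens (e (Ad a b)) (e a).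

Lemma Psi_e a b : Psi (tens (e a) (e b)) = tens (e (Ad a b)) (e a).
Proof.
have tE c d : tens (e a) (e b) (c, d) = ((c, d) == (a, b))%:R :> FunA4 R.
  by rewrite -[e a]scale1r tensZ_e; case: eqP.
rewrite /Psi pair_big /= (bigD1 (a, b)) //= big1 ?addr0.
  by rewrite tE eqxx scale1r.
by case=> c d /negPf cd; rewrite tE cd scale0r.
Qed.

Fact Psi_is_linear : linear Psi.
Proof.
move=> f w1 w2; rewrite /Psi scaler_sumr -big_split; apply: eq_bigr => a _ /=.
rewrite scaler_sumr -big_split; apply: eq_bigr => b _ /=.
by rewrite !ffunE scalerDl scalerA.
Qed.
HB.instance Definition _ :=
  GRing.isLinear.Build (FunA4 R) (Omega1x1 R) (Omega1x1 R) *:%R Psi Psi_is_linear.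

Lemma PsiE w a b : Psi w (a, b) = w (b, Ad (elt b)^-1%g a).
Proof.
have tE (c d : idx) : tens (e c) (e d) (a, b) = ((a, b) == (c, d))%:R :> FunA4 R.
  by rewrite -[e c]scale1r tensZ_e; case: eqP.
rewrite /Psi pair_big /= sum_ffunE (bigD1 (b, Ad (elt b)^-1%g a)) //= big1.
  by rewrite ffunE tE -AdM mulgV Ad1 eqxx [_ *: _]mulr1 addr0.
case=> c d /= cd; rewrite ffunE tE xpair_eqE.
case: eqP => [ac|_]; last by rewrite [LHS]mulr0.
case: eqP => [bc|_]; last by rewrite [LHS]mulr0.
by case/eqP: cd; rewrite ac bc -AdM mulVg Ad1.
Qed.

Lemma Psi_rmul w f : Psi (rmul1x1 w f) = rmul1x1 (Psi w) f.
Proof.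
apply/ffunP=> -[a b]; rewrite PsiE !ffunE PsiE /= -!RtransM.
by rewrite !mulgA mulgV mul1g invgK.
Qed.

Definition ker_id_Psi : pred (Omega1x1 R) := fun w => w - Psi w == 0.

Fact ker_id_Psi_zmod_closed : zmod_closed ker_id_Psi.
Proof.
split=> [|w1 w2]; rewrite !unfold_in; first by rewrite linear0 subr0.
rewrite !subr_eq0 => /eqP k1 /eqP k2.
by rewrite linearB /= -k1 -k2.
Qed.
HB.instance Definition _ :=
  GRing.isZmodClosed.Build (Omega1x1 R) ker_id_Psi ker_id_Psi_zmod_closed.

End Calculus.

Definition Omega2 (R : realType) : Type :=
  Quotient.quot (GRing.ZmodClosed.clone (Omega1x1 R) (@ker_id_Psi R) _).
HB.instance Definition _ (R : realType) := GRing.Zmodule.on (Omega2 R).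
HB.instance Definition _ (R : realType) :=
  EqQuotient.copy (Omega2 R)
    (Quotient.quot (GRing.ZmodClosed.clone (Omega1x1 R) (@ker_id_Psi R) _)).

Section Omega2.

Variable R : realType.
Implicit Types (f g : FunA4 R) (u v : Omega1 R) (w : Omega1x1 R) (q : Omega2 R).
Local Notation e := (e R).

Definition pi2 w : Omega2 R := \pi_(Omega2 R)%qT w.

Lemma pi2_eq w1 w2 : pi2 w1 = pi2 w2 <-> w1 - w2 = Psi (w1 - w2).
Proof.
rewrite /pi2; split=> [/eqP | wE].
  by rewrite -Quotient.idealrBE unfold_in subr_eq0 => /eqP.
by apply/eqP; rewrite -Quotient.idealrBE unfold_in subr_eq0; apply/eqP.
Qed.

Fact pi2_is_zmod_morphism : zmod_morphism pi2.
Proof. exact: raddfB. Qed.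
HB.instance Definition _ :=
  GRing.isZmodMorphism.Build (Omega1x1 R) (Omega2 R) pi2 pi2_is_zmod_morphism.

Definition repr2 q : Omega1x1 R := repr q.

Lemma repr2K : cancel repr2 pi2.
Proof. exact: reprK. Qed.

(* The left H-module structure of Omega2, f [w] = [f w]. *)
Definition scale2 f q : Omega2 R := pi2 (f *: repr2 q).

Lemma scale2E f w : scale2 f (pi2 w) = pi2 (f *: w).
Proof.
have /pi2_eq wE := repr2K (pi2 w).
by apply/pi2_eq; rewrite -scalerBr linearZ /= -wE.
Qed.

Fact scale2A f g q : scale2 f (scale2 g q) = scale2 (f * g) q.
Proof. by rewrite -[q]repr2K !scale2E scalerA. Qed.
Fact scale2_1 : left_id 1 scale2.
Proof. by move=> q; rewrite -[q]repr2K scale2E scale1r. Qed.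
Fact scale2Dr : right_distributive scale2 +%R.
Proof.
move=> f q1 q2; rewrite -[q1]repr2K -[q2]repr2K -raddfD !scale2E.
by rewrite scalerDr raddfD.
Qed.
Fact scale2Dl q : {morph scale2^~ q : f g / f + g}.
Proof. by move=> f g; rewrite -[q]repr2K !scale2E scalerDl raddfD. Qed.
HB.instance Definition _ :=
  GRing.Zmodule_isLmodule.Build (FunA4 R) (Omega2 R) scale2A scale2_1 scale2Dr scale2Dl.

Definition wedge u v : Omega2 R := pi2 (tens u v).
Local Notation "u ∧ v" := (wedge u v) (at level 40, left associativity).

Definition theta : Omega1 R := \sum_a e a.

Definition d0 f : Omega1 R := \sum_(a : idx) (Rtrans a f - f) *: e a.
Definition de (a : idx) : Omega2 R := theta ∧ e a + e a ∧ theta.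
Definition d1 u : Omega2 R :=
  \sum_(a : idx) (d0 (u a) ∧ e a + (u a : FunA4 R) *: de a).

Lemma d1Z_e f (a : idx) : d1 (f *: e a) = d0 f ∧ e a + f *: de a.
Proof.
have d00 : d0 0 = 0.
  by rewrite /d0 big1 // => b _; rewrite raddf0 subrr scale0r.
have wedge0 v : 0 ∧ v = 0.
  by rewrite /wedge -[0 : Omega1 R](scale0r v) tensZl scale0r raddf0.
have feE b : (f *: e a) b = (if b == a then f else 0) :> FunA4 R.
  by rewrite ffunE eE; case: eqP => _; [exact: mulr1 | exact: mulr0].
rewrite /d1 (bigD1 a) //= big1 => [|b /negPf ba].
  by rewrite feE eqxx addr0.
by rewrite feE ba d00 wedge0 scale0r addr0.
Qed.

Lemma d1_e a : d1 (e a) = de a.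
Proof.
rewrite -[in LHS](scale1r (e a)) d1Z_e scale1r.
rewrite [d0 1](_ : _ = 0); first by rewrite /wedge -[0](scale0r (e a)) tensZl scale0r raddf0 add0r.
by rewrite /d0 big1 // => b _; rewrite rmorph1 subrr scale0r.
Qed.

End Omega2.

Notation "u ∧ v" := (wedge u v) (at level 40, left associativity) : ring_scope.

Section Connections.

Variable R : realType.
Local Notation e := (e R).

(* eta^{a,b}; rows and columns of eta are numbered by an enumeration of idx. *)
Definition entry (eta : 'M[R[i]]_#|idx|) (a b : idx) : R[i] :=
  eta (enum_rank a) (enum_rank b).

Definition Ad_invariant (eta : 'M[R[i]]_#|idx|) : Prop :=
  forall (a b : idx) (g : A4),
    entry eta (Ad g^-1%g a) b = entry eta a (Ad g b).

Definition coframe (eta : 'M[R[i]]_#|idx|) (a : idx) : Omega1 R :=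
  \sum_(b : idx) rmul1 (e b) (cst (entry eta b a)).

Definition connection : Type := {ffun idx -> Omega1 R}.
Implicit Type A : connection.

Definition torsion_free A : Prop :=
  forall a : idx,
    d1 (e a) + \sum_(b : idx) A b ∧ (e (Ad (b : A4)^-1%g a) - e a) = 0.

Definition cotorsion_free (eta : 'M[R[i]]_#|idx|) A : Prop :=
  forall a : idx,
    d1 (coframe eta a)
      + \sum_(b : idx) (coframe eta (Ad b a) - coframe eta a) ∧ A b = 0.

Definition regular A : Prop :=
  forall g : A4, g != 1%g -> g \notin C ->
    \sum_(a : idx) \sum_(b : idx | ((a : A4) * (b : A4))%g == g) A a ∧ A b = 0.

Definition levi_civita (eta : 'M[R[i]]_#|idx|) A : Prop :=
  [/\ regular A, torsion_free A & cotorsion_free eta A].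

End Connections.

(* Main.v *)
Require Import Defs.
From HB Require Import structures.
From mathcomp Require Import all_boot all_order all_algebra all_fingroup.
From mathcomp Require Import reals complex ring.

(* The class C is identified with the field F_4 = F_2[w] in such a way that     *)
(* conjugation becomes the affine operation p |> q = w q + w^2 p. A 2-form      *)
(* vanishes iff its coefficients are constant along (p, q) -> (p |> q, p). Let  *)
(* b(h, a, c) be the coefficient along e_c, at h, of A_a - (e_a - theta / 4).   *)
(* Torsion freeness says that b(h, a, c) = phi_h (c |> a) with sum phi_h = 0.   *)
(* Since eta is a nonzero multiple of the identity plus a constant matrix,      *)
(* cotorsion freeness then says that phi_(hc) a depends only on h and a + c;    *)
(* call it chi_h (a + c). The regularity coefficient at (p, q) for the element  *)
(* m^-1 is a function of p + q plus chi_h (w^2 (m + q)); its invariance makes   *)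
(* chi_h (a + d) - chi_h a independent of a, hence 0, because replacing a by    *)
(* a + d changes its sign. So chi_h is constant with sum 0, hence 0, and b = 0. *)

(** The forms e_a - theta / 4 satisfy all three conditions because their own coefficients in each
    2-form are already invariant along (p, q) -> (p |> q, p), up to nonzero scaling and an added
    constant in the cotorsion case. Hence [torsion_freeP], [regularP] and [cotorsion_freeP] turn the
    conditions into equations in the deviation [dev] without constant term. Existence is the zero
    solution. Uniqueness says that it is the only one: [torsion_shape] reduces [dev] to its
    diagonal, and [regular_potential_eq0] makes the diagonal vanish. *)

Set Implicit Arguments.
Unset Strict Implicit.
Unset Printing Implicit Defensive.

Import GRing.Theory Num.Theory.
Local Open Scope ring_scope.

(* (u, v) stands for u + v w, where w is a generator of the field with four elements. *)
Definition F4 : Type := (bool * bool)%type.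
HB.instance Definition _ := GRing.Zmodule.on F4.
HB.instance Definition _ := Finite.on F4.

(** * Conjugation in C as an affine operation on F_4 *)

Definition mulw (p : F4) : F4 := (p.2, p.1 + p.2).

Definition conjF4 (p q : F4) : F4 := mulw q + mulw (mulw p).
Notation "p ▷ q" := (conjF4 p q) (at level 45, right associativity).

Lemma conjF4_inj p : injective (conjF4 p).
Proof. by case: p => [[] []] [[] []] [[] []]. Qed.

Lemma conjF4_inj_l q : injective (conjF4^~ q).
Proof. by case: q => [[] []] [[] []] [[] []]. Qed.

Lemma conjF4pp p : p ▷ p = p.
Proof. by case: p => [[] []]. Qed.

(** The relation reads w^2 p + w q + r = 0; multiplying by w permutes its coefficients
    cyclically. *)
Lemma conjF4_eq_rot p q r : (p ▷ q == r) = (q ▷ r == p).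
Proof. by case: p q r => [[] []] [[] []] [[] []]. Qed.

Lemma conjF4K p q : q ▷ p ▷ q = p.
Proof. by apply/eqP; rewrite -conjF4_eq_rot. Qed.

Lemma conjF4Kl p q : (p ▷ q) ▷ p = q.
Proof. by apply/eqP; rewrite conjF4_eq_rot. Qed.

Lemma conjF4_eqr p q : (p ▷ q == p) = (p == q).
Proof. by case: p q => [[] []] [[] []]. Qed.

Lemma conjF4_eql p q : (p ▷ q == q) = (p == q).
Proof. by case: p q => [[] []] [[] []]. Qed.

Lemma sumF4 (V : nmodType) (f : F4 -> V) : \sum_p f p =
  f (true, true) + f (true, false) + (f (false, true) + f (false, false)).
Proof.
rewrite (eq_bigr (fun p => f (p.1, p.2))) => [|[] //].
by rewrite -(pair_bigA _ (fun u v => f (u, v))) /= !big_bool.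
Qed.

Lemma sumF4_delta (V : pzRingType) (f : F4 -> V) q : \sum_p (p == q)%:R * f p = f q.
Proof.
rewrite (bigD1 q) //= eqxx mul1r big1 ?addr0 // => p /negPf ->.
by rewrite mul0r.
Qed.

(** * The functional equations on F_4 that force uniqueness *)

Section Uniqueness.
Variable F : numFieldType.

(** Taking [d = a] expresses each entry by a diagonal one and the column sum [S]. Summing over [a]
    shows that [S] is constant, and one instance with [a = c] and [d != c] makes it vanish. *)
Lemma torsion_shape (b : F4 -> F4 -> F) (S : F4 -> F) :
    (forall c, S c = \sum_a b a c) ->
    (forall a c d, b (c ▷ a) (c ▷ d) - (c == a)%:R * S (c ▷ d)
       = b (d ▷ a) c - (d == a)%:R * S c) ->
  (forall c, S c = 0) /\ (forall a c, b a c = b (c ▷ a) (c ▷ a)).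
Proof.
move=> SE inv_b.
have diag a c : b a c = b (c ▷ a) (c ▷ a) + S c - (a == c)%:R * S c.
  have := inv_b a c a; rewrite conjF4pp eqxx [c == a]eq_sym.
  case: eqP => [->|_]; first by rewrite conjF4pp mul1r addrK.
  by rewrite !mul0r !mul1r !subr0 => ->; rewrite subrK.
pose T := \sum_a b a a.
have ST c : 2 * S c = - T.
  have : S c = T + 4 * S c - S c.
    rewrite {1}SE (eq_bigr _ (fun a _ => diag a c)) big_split big_split /= sumrN.
    rewrite sumF4_delta (sumF4 (fun=> S c)) /T.
    rewrite [in RHS](reindex_inj (@conjF4_inj c)) /=; ring.
  move=> E; apply/eqP; rewrite -subr_eq0 opprK; apply/eqP.
  by rewrite (_ : _ + T = T + 4 * S c - S c - S c); [rewrite -E subrr | ring].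
have S0 c : S c = 0.
  have Sconst c' : S c' = S c.
    by apply: (@mulfI _ 2); rewrite ?pnatr_eq0 // !ST.
  (* Any point other than [c] serves: both entries of this instance reduce to [b d d + S c], which
     leaves one unmatched [S c]. *)
  pose d := c + (true, false).
  have := inv_b c c d; rewrite eqxx mul1r.
  have /negPf -> : d != c by rewrite /d; case: c {Sconst} @d => [[] []].
  rewrite mul0r subr0 conjF4pp Sconst (diag c) conjF4Kl.
  have /negPf -> : c != c ▷ d.
    by rewrite eq_sym conjF4_eqr /d; case: c {Sconst} @d => [[] []].
  rewrite (diag (d ▷ c)) conjF4K Sconst.
  have /negPf -> : d ▷ c != c.
    by rewrite conjF4_eql /d; case: c {Sconst} @d => [[] []].
  rewrite !mul0r !subr0 addrK => /eqP.
  by rewrite -subr_eq0 opprD addNKr oppr_eq0 => /eqP.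
split=> // a c; rewrite diag S0; ring.
Qed.

(** [phi] is the potential at a group element h, and [psi c] the one at h c. Once the [psi c] are
    translates of a single [chi], the quadratic term depends only on [p + q] when [m = 0], so it
    cancels between two instances and a linear relation on [chi] remains. *)
Lemma regular_potential_eq0 (phi : F4 -> F) (psi : F4 -> F4 -> F) :
    (forall c, \sum_a psi c a = 0) ->
    (forall a c d, psi (c ▷ d) (c ▷ (a ▷ (c ▷ d))) = psi c (d ▷ (a ▷ c))) ->
    (forall m c d (W := fun p q => \sum_a phi (p ▷ a) * psi p (q ▷ (a ▷ m))
         + psi p (q ▷ (p ▷ m)) + phi (p ▷ (m ▷ q))),
       W (c ▷ d) c = W c d) ->
  forall c a, psi c a = 0.
Proof.
move=> psi_sum psi_shift inv_W.
pose chi a := psi 0 a.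
have psiE c a : psi c a = chi (a + c).
  (* The arguments are chosen so that [c ▷ mulw c = 0]. *)
  have := psi_shift (a + mulw c) c (mulw c).
  rewrite (_ : c ▷ _ = 0); last by case: c => [[] []].
  rewrite (_ : c ▷ _ = a + c); last by case: a c => [[] []] [[] []].
  by rewrite (_ : _ ▷ _ = a) //; case: a c => [[] []] [[] []].
have chi_shift a d : chi (a + d) = chi a.
  pose G d := \sum_s phi s * chi (mulw (mulw (s + d))) + phi (mulw (mulw d)).
  have W c e : chi (mulw (mulw c)) + G (mulw e) = chi (mulw (mulw (c + e))) + G e.
    have WE p q : \sum_a phi (p ▷ a) * psi p (q ▷ (a ▷ 0))
         + psi p (q ▷ (p ▷ 0)) + phi (p ▷ (0 ▷ q)) = chi (mulw (mulw q)) + G (p + q).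
      rewrite [RHS]addrCA addrA /G [in RHS](reindex_inj (@conjF4_inj p)) /=.
      congr (_ + _ + _).
      - apply: eq_bigr => s _; rewrite psiE; congr (_ * chi _).
        by case: p q s => [[] []] [[] []] [[] []].
      - by rewrite psiE; congr chi; case: p q => [[] []] [[] []].
      - by congr phi; case: p q => [[] []] [[] []].
    have := inv_W 0 c (c + e); rewrite /= !WE.
    rewrite (_ : c ▷ _ + c = mulw e); last by case: c e => [[] []] [[] []].
    by rewrite (_ : c + (c + e) = e); last by case: c e => [[] []] [[] []].
  (* The increment of [chi] along [d] is a difference of values of [G] that does not involve the
     base point, yet the base points [a] and [a + d] give opposite increments. *)
  have := W (mulw a) (mulw d); have := W (mulw (a + d)) (mulw d).
  rewrite (_ : mulw (mulw (mulw (a + d))) = a + d); last by case: a d => [[] []] [[] []].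
  rewrite (_ : mulw (mulw (mulw a)) = a); last by case: a => [[] []].
  rewrite (_ : mulw (mulw (_ + _)) = a); last by case: a d => [[] []] [[] []].
  rewrite (_ : mulw (mulw (_ + _)) = a + d); last by case: a d => [[] []] [[] []].
  set u := chi (a + d); set v := chi a; set g := G _; set g' := G _ => E1 E2.
  apply: (@mulfI _ 2); first by rewrite pnatr_eq0.
  have -> : 2 * u = (u + g) + (u + g') - (g + g') by ring.
  by rewrite E1 -E2; ring.
have chi_cst a : chi a = chi 0 by rewrite -[RHS](chi_shift 0 a) add0r.
move=> c a; rewrite psiE chi_cst; apply: (@mulfI _ 4); rewrite ?pnatr_eq0 //.
rewrite mulr0 -(psi_sum c) sumF4.
by rewrite !psiE !(chi_cst (_ + _)); ring.
Qed.
End Uniqueness.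

(** * The identification of C with F_4 *)

Lemma t_in_C : t \in C. Proof. by rewrite !inE eqxx. Qed.
Lemma x_in_C : x \in C. Proof. by rewrite !inE eqxx !orbT. Qed.
Lemma y_in_C : y \in C. Proof. by rewrite !inE eqxx !orbT. Qed.
Lemma z_in_C : z \in C. Proof. by rewrite !inE eqxx !orbT. Qed.

Definition idxF4 (p : F4) : idx :=
  match p with
  | (false, false) => Idx t_in_C
  | (true, false) => Idx x_in_C
  | (false, true) => Idx z_in_C
  | (true, true) => Idx y_in_C
  end.

Lemma Ad_idxF4 p q : Ad (idxF4 p) (idxF4 q) = idxF4 (p ▷ q).
Proof.
do 2 apply: val_inj.
case: p q => [[] []] [[] []]; rewrite [LHS]conj_cycle3 /= !permM !permE /=;
  by do ?[reflexivity | rewrite cycle3_rot //].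
Qed.

(** The product of two elements of C is thus the inverse of an element of C, so the group equations
    in [regular] become equations in F_4. *)
Lemma idxF4_mul p q : ((idxF4 p : A4) * idxF4 q * idxF4 (q ▷ p) = 1)%g.
Proof.
apply: A4P; elim/forall_ord4; rewrite !A4_mulE perm1;
  by case: p q => [[] []] [[] []] /=; rewrite /cycle3 !permM !permE.
Qed.

Lemma idxF4_inj : injective idxF4.
Proof.
(* The four cycles send [p1] to four different points. *)
move=> p q /(congr1 (fun a : idx => val (val a) p1)) E; apply/eqP; move: E.
by case: p q => [[] []] [[] []] //=; rewrite !permM !permE.
Qed.

Lemma idxF4_bij : bijective idxF4.
Proof.
apply: inj_card_bij idxF4_inj _.
rewrite -(card_codom idxF4_inj); apply/subset_leq_card/subsetP => -[a aC] _.
have := aC; rewrite !inE -!orbA => /or4P[] /eqP E; apply/codomP.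
- by exists (false, false); apply: val_inj.
- by exists (true, false); apply: val_inj.
- by exists (true, true); apply: val_inj.
- by exists (false, true); apply: val_inj.
Qed.

Lemma sum_idxF4 (V : nmodType) (f : idx -> V) : \sum_a f a = \sum_p f (idxF4 p).
Proof. by rewrite (reindex idxF4) //; apply: onW_bij; exact: idxF4_bij. Qed.

(** * Torsion and regularity in coordinates *)

Section Components.
Variable R : realType.
Implicit Types (h : A4) (u w : Omega1 R) (A : connection R) (a b c d p q m : F4).

(** [Psi] only permutes the coefficients, so the kernel of id - [Psi] is the fixed space of that
    permutation. *)
Lemma pi2_eq0 (w : Omega1x1 R) : pi2 w = 0 <->
  forall h p q, (w (idxF4 (p ▷ q), idxF4 p) : FunA4 R) h
              = (w (idxF4 p, idxF4 q) : FunA4 R) h.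
Proof.
rewrite -[X in _ = X](raddf0 (@pi2 R)); split=> [/pi2_eq | inv_w].
  rewrite subr0 => {1}-> h p q.
  by rewrite PsiE -Ad_idxF4 -AdM mulVg Ad1.
apply/pi2_eq; rewrite subr0; apply/ffunP=> -[i j]; rewrite PsiE.
have [g gK Kg] := idxF4_bij.
rewrite -(Kg i) -(Kg j); apply/ffunP=> h.
have -> : idxF4 (g i) = Ad (idxF4 (g j)) (Ad (elt (idxF4 (g j)))^-1%g (idxF4 (g i))).
  by rewrite -AdM mulgV Ad1.
rewrite -(Kg (Ad _ (idxF4 (g i)))) Ad_idxF4 inv_w; congr (w (_, _) h).
by rewrite -Ad_idxF4 -AdM mulVg Ad1.
Qed.

Lemma Omega1x1_addE (w1 w2 : Omega1x1 R) i h :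
  ((w1 + w2) i : FunA4 R) h = (w1 i : FunA4 R) h + (w2 i : FunA4 R) h.
Proof. by rewrite !ffunE. Qed.

Lemma Omega1x1_sumE (I : finType) (w : I -> Omega1x1 R) i h :
  ((\sum_a w a) i : FunA4 R) h = \sum_a (w a i : FunA4 R) h.
Proof. by rewrite !sum_ffunE. Qed.

Lemma tens_idxF4 u w c d h : (tens u w (idxF4 c, idxF4 d) : FunA4 R) h
  = (u (idxF4 c) : FunA4 R) h * (w (idxF4 d) : FunA4 R) (h * idxF4 c)%g.
Proof. by rewrite tensE !ffunE. Qed.

Lemma e_idxF4 a c h : (e R (idxF4 a) (idxF4 c) : FunA4 R) h = (c == a)%:R.
Proof.
rewrite eE (inj_eq idxF4_inj).
by case: (c == a); rewrite ffunE.
Qed.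

Lemma theta_idxF4 c h : (theta R (idxF4 c) : FunA4 R) h = 1.
Proof.
rewrite /theta sum_idxF4 !sum_ffunE (eq_bigr (fun a => (a == c)%:R * 1)).
  by rewrite (sumF4_delta (fun=> 1)).
by move=> a _; rewrite e_idxF4 mulr1 eq_sym.
Qed.

Lemma Ad_inv_idxF4 b a : Ad (idxF4 b : A4)^-1%g (idxF4 a) = idxF4 (a ▷ b).
Proof.
have /eqP E : b ▷ (a ▷ b) == a by rewrite conjF4K.
by rewrite -[in LHS]E -Ad_idxF4 -AdM mulVg Ad1.
Qed.

(* The component of A_a - (e_a - theta / 4) along e_c. *)
Definition dev A h a c : R[i] :=
  (A (idxF4 a) (idxF4 c) : FunA4 R) h - ((a == c)%:R - 4^-1).

Lemma devE A h a c :
  (A (idxF4 a) (idxF4 c) : FunA4 R) h = dev A h a c + ((a == c)%:R - 4^-1).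
Proof. by rewrite subrK. Qed.

Definition devsum A h c : R[i] := \sum_a dev A h a c.

Lemma devsumE A h c :
  \sum_a (A (idxF4 a) (idxF4 c) : FunA4 R) h = devsum A h c.
Proof.
rewrite /devsum [RHS]sumrB sumrB -[LHS]subr0; congr (_ - _); apply/esym/eqP.
rewrite subr_eq0 (sumF4 (fun=> 4^-1)); apply/eqP.
under eq_bigr => a _ do rewrite -[_%:R]mulr1.
by rewrite (sumF4_delta (fun=> 1)); field.
Qed.

(** Counts [a] among the first entries [c], [c ▷ d], [d] of the successive pairs obtained from (c,
    d), a 3-cycle or a fixed point; hence its invariance. *)
Definition tau a c d : R[i] := (c == a)%:R + (d == a)%:R + (c ▷ d == a)%:R.

Lemma tau_conj a c d : tau a (c ▷ d) c = tau a c d.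
Proof. by rewrite /tau conjF4Kl; ring. Qed.

Lemma torsion_freeP A : torsion_free A <-> forall h a c d,
  dev A h (c ▷ a) (c ▷ d) - (c == a)%:R * devsum A h (c ▷ d)
    = dev A h (d ▷ a) c - (d == a)%:R * devsum A h c.
Proof.
pose w (a : idx) : Omega1x1 R := tens (theta R) (e R a) + tens (e R a) (theta R)
  + \sum_b tens (A b) (e R (Ad (elt b)^-1%g a) - e R a).
(* The last summand is the coefficient for e_a - theta / 4; being invariant, it drops out. *)
have wE a c d h : (w (idxF4 a) (idxF4 c, idxF4 d) : FunA4 R) h
    = dev A h (d ▷ a) c - (d == a)%:R * devsum A h c + (tau a c d - 4^-1).
  rewrite /w sum_idxF4 !Omega1x1_addE Omega1x1_sumE !tens_idxF4 !theta_idxF4 !e_idxF4.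
  rewrite (eq_bigr (fun b => (b == d ▷ a)%:R * (A (idxF4 b) (idxF4 c) : FunA4 R) h
     - (d == a)%:R * (A (idxF4 b) (idxF4 c) : FunA4 R) h)); last first.
    move=> b _; rewrite tens_idxF4 !ffunE Ad_inv_idxF4 !e_idxF4.
    by rewrite eq_sym -conjF4_eq_rot eq_sym; ring.
  rewrite sumrB sumF4_delta -mulr_sumr devsumE devE /tau.
  rewrite (conjF4_eq_rot c d a); ring.
have tE (a : idx) : d1 (e R a) + \sum_b A b ∧ (e R (Ad (b : A4)^-1%g a) - e R a)
    = pi2 (w a).
  by rewrite d1_e /w !raddfD raddf_sum.
split=> [A_tf h a c d | inv_A a].
  have := A_tf (idxF4 a); rewrite tE => /pi2_eq0/(_ h c d).
  by rewrite !wE tau_conj => /addIr.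
have [g _ gK] := idxF4_bij; rewrite -(gK a) tE; apply/pi2_eq0 => h c d.
by rewrite !wE tau_conj inv_A.
Qed.

Lemma idxF4_neq1 p : elt (idxF4 p) != 1%g.
Proof.
apply/eqP=> p1; have := conjF4_eql p (p + (true, false)).
rewrite -(inj_eq idxF4_inj) -Ad_idxF4 p1 Ad1 eqxx.
by case: p {p1} => [[] []].
Qed.

Lemma idxF4_mulE a b (g : A4) :
  ((idxF4 a : A4) * (idxF4 b : A4) == g)%g = (elt (idxF4 (b ▷ a)) == g^-1)%g.
Proof.
have /eqP := idxF4_mul a b; rewrite -eq_invg_mul => /eqP <-.
by rewrite (inj_eq (@invg_inj _)).
Qed.

Lemma idxF4_invC m : (elt (idxF4 m))^-1%g \notin C.
Proof.
apply/negP=> mC; have [g _ gK] := idxF4_bij.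
have := idxF4_mulE m (g (Idx mC)) 1%g; rewrite gK mulgV eqxx invg1.
by rewrite (negPf (idxF4_neq1 _)).
Qed.

(** For g = m^-1 with m in C, the pairs with a b = g are those with b = a |> m; for the other g the
    sum is empty. The part free of [dev] is invariant by [const_conj]. *)
Lemma regularP A : regular A <-> forall h m c d (W := fun p q =>
    \sum_a dev A h a p * dev A (h * idxF4 p)%g (a ▷ m) q
      + (dev A (h * idxF4 p)%g (p ▷ m) q - 4^-1 * devsum A (h * idxF4 p)%g q)
      + (dev A h (m ▷ q) p - 4^-1 * devsum A h p)),
  W (c ▷ d) c = W c d.
Proof.
pose w m : Omega1x1 R := \sum_a tens (A (idxF4 a)) (A (idxF4 (a ▷ m))).
have wE m c d h : (w m (idxF4 c, idxF4 d) : FunA4 R) h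
    = \sum_a dev A h a c * dev A (h * idxF4 c)%g (a ▷ m) d
      + (dev A (h * idxF4 c)%g (c ▷ m) d - 4^-1 * devsum A (h * idxF4 c)%g d)
      + (dev A h (m ▷ d) c - 4^-1 * devsum A h c) + ((c ▷ m == d)%:R - 4^-1).
  rewrite /w Omega1x1_sumE.
  under eq_bigr => a _ do rewrite tens_idxF4 devE (devE _ (h * _)%g).
  transitivity (\sum_a (dev A h a c * dev A (h * idxF4 c)%g (a ▷ m) d
     + ((a == c)%:R * dev A (h * idxF4 c)%g (a ▷ m) d
         - 4^-1 * dev A (h * idxF4 c)%g (a ▷ m) d)
     + ((a == m ▷ d)%:R * dev A h a c - 4^-1 * dev A h a c)
     + ((a == c)%:R * (a ▷ m == d)%:R - 4^-1 * ((a == c)%:R * 1)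
        - 4^-1 * ((a == m ▷ d)%:R * 1) + 4^-1 * 4^-1))).
    by apply: eq_bigr => a _; rewrite (conjF4_eq_rot a) (eq_sym (m ▷ d)); ring.
  rewrite !big_split /= !sumrN -!mulr_sumr !sumF4_delta (sumF4 (fun=> 4^-1)).
  have -> : \sum_i dev A (h * idxF4 c)%g (i ▷ m) d = devsum A (h * idxF4 c)%g d.
    by rewrite /devsum [RHS](reindex_inj (@conjF4_inj_l m)).
  by rewrite -/(devsum A h c); field.
have const_conj m c d : ((c ▷ d) ▷ m == c) = (c ▷ m == d).
  by case: c d m => [[] []] [[] []] [[] []].
have sumE m (g : A4) : g = (elt (idxF4 m))^-1%g ->
    \sum_(a : idx) \sum_(b : idx | ((a : A4) * (b : A4) == g)%g) A a ∧ A b = pi2 (w m).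
  move=> ->; rewrite /w raddf_sum sum_idxF4; apply: eq_bigr => a _.
  rewrite big_mkcond sum_idxF4 -big_mkcond (big_pred1 (a ▷ m)) // => b.
  by rewrite idxF4_mulE invgK (inj_eq val_inj) (inj_eq idxF4_inj) conjF4_eq_rot eq_sym.
split=> [A_reg h m c d | inv_A g _ _].
  have := A_reg (elt (idxF4 m))^-1%g; rewrite (sumE m) // invg_eq1.
  move=> /(_ (idxF4_neq1 m) (idxF4_invC m)) /pi2_eq0/(_ h c d).
  by rewrite !wE const_conj => /addIr.
have [m /eqP gm | no_m] := pickP (fun m => elt (idxF4 m) == g^-1)%g.
  rewrite (sumE m) ?gm ?invgK //; apply/pi2_eq0 => h c d.
  by rewrite !wE const_conj [X in X + _]inv_A.
rewrite sum_idxF4 big1 // => a _; rewrite big_mkcond sum_idxF4 big1 // => b _.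
by rewrite idxF4_mulE no_m.
Qed.
End Components.

(** * Invariant metrics and cotorsion in coordinates *)

Section Coframe.
Variable R : realType.
Implicit Types (h : A4) (A : connection R) (a b c d p q m : F4) (eta : 'M[R[i]]_#|idx|).

(** The maps q -> r |> q generate the affine maps q -> w^k q + s, which act doubly transitively on
    F_4, so [eta] has one diagonal and one off-diagonal value. If these agreed, two rows would
    coincide. *)
Lemma Ad_invariant_entry eta : eta \in unitmx -> Ad_invariant eta ->
  exists al be : R[i], al != 0 /\
    forall p q, entry eta (idxF4 p) (idxF4 q) = al * (p == q)%:R + be.
Proof.
move=> eta_unit eta_Ad.
pose E p q := entry eta (idxF4 p) (idxF4 q).
have E_conj r p q : E (r ▷ p) (r ▷ q) = E p q.
  by rewrite /E -!Ad_idxF4 -eta_Ad -AdM mulVg Ad1.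
have E_mulw p q : E (mulw p) (mulw q) = E p q.
  rewrite -(E_conj 0 p q).
  by congr E; rewrite /conjF4 addr0.
have E_add r p q : E (p + r) (q + r) = E p q.
  rewrite -[RHS]E_mulw -[RHS]E_mulw -[RHS](E_conj (mulw r)).
  by congr E; [case: p r => [[] []] [[] []] | case: q r => [[] []] [[] []]].
have E0 p q : E p q = E 0 (p + q).
  rewrite -(E_add p).
  by congr E; [case: p => [[] []] | case: p q => [[] []] [[] []]].
pose be := E 0 (true, false).
have E0const d : d != 0 -> E 0 d = be.
  case: d => [[] []] // _.
    by rewrite /be -[LHS]E_mulw; congr E.
  by rewrite /be -[RHS]E_mulw; congr E.
have entryE p q : E p q = (E 0 0 - be) * (p == q)%:R + be.
  rewrite E0; case: eqP => [<-|/eqP pq].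
    by rewrite mulr1 subrK; congr E; case: p => [[] []].
  rewrite mulr0 add0r E0const //.
  by case: p q pq => [[] []] [[] []].
exists (E 0 0 - be), be; split=> //; apply/eqP=> al0.
have rank_neq : enum_rank (idxF4 0) != enum_rank (idxF4 (true, false)).
  by rewrite (inj_eq enum_rank_inj) (inj_eq idxF4_inj).
have row_eq : row (enum_rank (idxF4 0)) eta = row (enum_rank (idxF4 (true, false))) eta.
  apply/rowP=> j; rewrite !mxE; have [g _ gK] := idxF4_bij.
  rewrite -(enum_valK j) -(gK (enum_val j)).
  by have := entryE 0 (g (enum_val j)); have := entryE (true, false) (g (enum_val j));
    rewrite al0 !mul0r !add0r /E /entry => -> ->.
have := congr1 (fun v => (v *m invmx eta) 0 (enum_rank (idxF4 0))) row_eq.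
rewrite /= -!row_mul mulmxV // !mxE eqxx eq_sym (negPf rank_neq).
by move/eqP; rewrite oner_eq0.
Qed.

Lemma coframe_entry eta a c :
  coframe eta (idxF4 a) (idxF4 c) = cst (entry eta (idxF4 c) (idxF4 a)).
Proof.
rewrite /coframe sum_ffunE (bigD1 (idxF4 c)) //= big1 ?addr0; last first.
  by move=> b /negPf bc; rewrite ffunE eE eq_sym bc mul0r.
rewrite ffunE eE eqxx mul1r.
by apply/ffunP=> h; rewrite !ffunE.
Qed.

Lemma d1_cst (u : Omega1 R) (k : F4 -> R[i]) :
    (forall b, u (idxF4 b) = cst (k b) :> FunA4 R) ->
  d1 u = \sum_b (cst (k b) : FunA4 R) *: de R (idxF4 b).
Proof.
move=> uE; rewrite /d1 sum_idxF4; apply: eq_bigr => b _; rewrite uE.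
have -> : d0 (cst (k b)) = 0.
  rewrite /d0 big1 // => a _; rewrite (_ : Rtrans a _ = cst (k b)) ?subrr ?scale0r //.
  by apply/ffunP=> h; rewrite !ffunE.
by rewrite /wedge -[0](scale0r (e R (idxF4 b))) tensZl scale0r raddf0 add0r.
Qed.

(** The coframe is al e_a + be theta; the theta part cancels in coframe differences and otherwise
    adds the constant 2 be. The connection is now the right factor, so [dev] is taken at h p. *)
Lemma cotorsion_freeP eta (al be : R[i]) A : al != 0 ->
    (forall p q, entry eta (idxF4 p) (idxF4 q) = al * (p == q)%:R + be) ->
  cotorsion_free eta A <-> forall h a c d
    (T := fun p q => dev A (h * idxF4 p)%g (a ▷ p) q
       - (p == a)%:R * devsum A (h * idxF4 p)%g q),
  T (c ▷ d) c = T c d.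
Proof.
move=> al_neq0 etaE.
have coE a c h : (coframe eta (idxF4 a) (idxF4 c) : FunA4 R) h = al * (c == a)%:R + be.
  by rewrite coframe_entry ffunE etaE.
pose w (a : idx) : Omega1x1 R :=
  \sum_b (cst (entry eta (idxF4 b) a) : FunA4 R) *:
     (tens (theta R) (e R (idxF4 b)) + tens (e R (idxF4 b)) (theta R))
  + \sum_b tens (coframe eta (Ad (elt b) a) - coframe eta a) (A b).
have wE a c d h : (w (idxF4 a) (idxF4 c, idxF4 d) : FunA4 R) h
    = al * (dev A (h * idxF4 c)%g (a ▷ c) d
       - (c == a)%:R * devsum A (h * idxF4 c)%g d + (tau R a c d - 4^-1)) + 2 * be.
  rewrite /w sum_idxF4 Omega1x1_addE !Omega1x1_sumE.
  rewrite (eq_bigr (fun b => (b == d)%:R * (al * (b == a)%:R + be)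
     + (b == c)%:R * (al * (b == a)%:R + be))); last first.
    move=> b _.
    rewrite ffunE [X in fun_of_fin X h]/GRing.scale /= ffunE Omega1x1_addE !tens_idxF4.
    by rewrite !theta_idxF4 !e_idxF4 ffunE etaE (eq_sym d) (eq_sym c); ring.
  rewrite [X in _ + X](eq_bigr (fun b => al * ((b == a ▷ c)%:R
       * (A (idxF4 b) (idxF4 d) : FunA4 R) (h * idxF4 c)%g
     - (c == a)%:R * (A (idxF4 b) (idxF4 d) : FunA4 R) (h * idxF4 c)%g))); last first.
    move=> b _; rewrite tens_idxF4 Ad_idxF4 !ffunE !coE.
    by rewrite (eq_sym c (b ▷ a)) conjF4_eq_rot (eq_sym _ b); ring.
  rewrite big_split -mulr_sumr sumrB -mulr_sumr !sumF4_delta devsumE devE /tau.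
  rewrite (conjF4_eq_rot c d) (conjF4_eq_rot d a) /=; ring.
have tE (a : idx) : d1 (coframe eta a)
    + \sum_(b : idx) (coframe eta (Ad b a) - coframe eta a) ∧ A b = pi2 (w a).
  have [g _ gK] := idxF4_bij.
  have coE' b : coframe eta a (idxF4 b) = cst (entry eta (idxF4 b) a).
    by rewrite -(gK a) coframe_entry.
  rewrite (d1_cst coE') /w raddfD !raddf_sum; congr (_ + _).
  apply: eq_bigr => b _; rewrite /de /wedge -raddfD; exact: scale2E.
split=> [A_ctf h a c d | inv_A a].
  have := A_ctf (idxF4 a); rewrite tE => /pi2_eq0/(_ h c d).
  by rewrite !wE tau_conj => /addIr/(mulfI al_neq0)/addIr.
have [g _ gK] := idxF4_bij; rewrite -(gK a) tE; apply/pi2_eq0 => h c d.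
rewrite !wE tau_conj; congr (al * (_ + _) + _); exact: inv_A.
Qed.
End Coframe.

(** * Existence and uniqueness *)

Lemma dev_eq0 (R : realType) (A : connection R) :
  (forall a, A a = e R a - cst (4^-1) *: theta R) <-> forall h a c, dev A h a c = 0.
Proof.
have A0E h a c : ((e R (idxF4 a) - cst (4^-1) *: theta R) (idxF4 c) : FunA4 R) h
    = (a == c)%:R - 4^-1.
  by rewrite !ffunE e_idxF4 theta_idxF4 mulr1 eq_sym.
split=> [AE h a c | A_dev a]; first by rewrite /dev AE A0E subrr.
have [g _ gK] := idxF4_bij; rewrite -(gK a).
apply/ffunP=> c; rewrite -(gK c); apply/ffunP=> h.
by rewrite A0E devE A_dev add0r.
Qed.

Lemma levi_civita_dev_eq0 (R : realType) (eta : 'M[R[i]]_#|idx|) (A : connection R) :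
  eta \in unitmx -> Ad_invariant eta ->
  levi_civita eta A <-> forall h a c, dev A h a c = 0.
Proof.
move=> eta_unit /(Ad_invariant_entry eta_unit)[al [be [al_neq0 etaE]]].
split=> [[/regularP A_reg /torsion_freeP A_tf A_ctf] | A0].
  have A_coreg := (cotorsion_freeP A al_neq0 etaE).1 A_ctf.
  have shape h := torsion_shape (fun c => erefl (devsum A h c)) (A_tf h).
  have S0 h c : devsum A h c = 0 by case: (shape h).
  have devd h a c : dev A h a c = dev A h (c ▷ a) (c ▷ a) by case: (shape h).
  have diag0 (h : A4) : forall c a, dev A (h * idxF4 c)%g a a = 0.
    apply: (@regular_potential_eq0 _ (fun a => dev A h a a)).
    - move=> c; rewrite -[RHS](S0 (h * idxF4 c)%g c) /devsum.
      under [RHS]eq_bigr => a _ do rewrite devd.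
      by rewrite [LHS](reindex_inj (@conjF4_inj c)).
    - move=> a c d; have := A_coreg h a c d.
      by rewrite /= !S0 !mulr0 !subr0 devd (devd _ (a ▷ c)).
    - move=> m c d /=; have := A_reg h m c d; rewrite /= !S0 !mulr0 !subr0.
      rewrite -!devd; under [in X in _ -> X = _]eq_bigr => a _ do rewrite -!devd.
      by under [in X in _ -> _ = X]eq_bigr => a _ do rewrite -!devd.
  (* Every group element is a product h c with c in C, so vanishing at these products suffices. *)
  move=> h a c; rewrite devd.
  by have := diag0 (h * (idxF4 0 : A4)^-1)%g 0 (c ▷ a); rewrite mulgKV.
have S0 h c : devsum A h c = 0 by rewrite /devsum big1.
split.
- have Q0 h h' m p q : \sum_a dev A h a p * dev A h' (a ▷ m) q = 0.
    by apply: big1 => a _; rewrite A0 mul0r.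
  by apply/regularP => h m c d W; rewrite /W !Q0 !S0 !A0.
- by apply/torsion_freeP => h a c d; rewrite !S0 !A0 !mulr0.
- apply: (cotorsion_freeP A al_neq0 etaE).2 => h a c d T.
  by rewrite /T !S0 !A0 !mulr0.
Qed.

Theorem proposition4p1 (R : realType) (eta : 'M[R[i]]_#|idx|)
    (eta_nondegenerate : eta \in unitmx) (eta_Ad : Ad_invariant eta) :
  exists A : connection R,
    unique (levi_civita eta) A /\
    forall a : idx, A a = e R a - cst (4^-1) *: theta R.
Proof.
have lcP A := iff_trans (levi_civita_dev_eq0 A eta_nondegenerate eta_Ad)
  (iff_sym (dev_eq0 A)).
pose A0 : connection R := [ffun a => e R a - cst (4^-1) *: theta R].
have A0E a : A0 a = e R a - cst (4^-1) *: theta R by rewrite ffunE.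
exists A0; split=> //; split=> [|A /lcP AE]; first exact/lcP.
by apply/ffunP=> a; rewrite A0E AE.
Qed.
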